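(* Let $\mathcal{G}$ be one of the classes (a) $(P_4\cup rK_1)$-free graphs with $r\geq 0$, (b) $(P_3\cup rK_1)$-free graphs with $r\geq 0$, (c) $(K_2\cup rK_1)$-free graphs with $r\geq 1$, or (d) $rK_1$-free graphs with $r\geq 3$. Then for every fixed $r$ and every graph $G\in\mathcal{G}$: (i) $G$ has only polynomially many (in $|V(G)|$) open packings, (ii) all open packings of $G$ can be found in polynomial time, and hence the open packing number $\rho^o(G)$ can be computed in polynomial time.
   Context: All graphs are finite, simple and undirected. For a graph $G$ and $x\in V(G)$, $N_G(x)$ is the set of neighbours of $x$. A vertex subset $S$ of $G$ is an open packing if $N_G(x)\cap N_G(y)=\emptyset$ for every pair of distinct $x,y\in S$; $\rho^o(G)$ is the maximum size of an open packing. A graph $G$ is $H$-free if no induced subgraph of $G$ is isomorphic to $H$. $P_t$ is the path on $t$ vertices, $K_2$ is an edge, $\cup$ denotes disjoint union, and $rK_1$ is the edgeless graph on $r$ vertices.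
   Formalization: In (a)–(c), claims (i) and (ii) are made only for graphs that are connected or contain P_4, P_3 or K_2 respectively as an induced subgraph, since edgeless graphs have 2^n open packings; computing the open packing number, and all of (d), are unrestricted. *)

(* Defs.v *)
From mathcomp Require Import all_boot all_algebra.
Set Implicit Arguments.
Unset Strict Implicit.
Unset Printing Implicit Defensive.

Record sgraph := SGraph {
  vertex :> finType;
  edge : rel vertex;
  edge_sym : symmetric edge;
  edge_irr : irreflexive edge }.

Definition neighbours (G : sgraph) (x : G) : {set G} := [set y | edge x y].

Definition open_packing (G : sgraph) (S : {set G}) : bool :=
  [forall x in S, forall y in S,
     (x != y) ==> (neighbours x :&: neighbours y == set0)].

Definition open_packings (G : sgraph) : {set {set G}} :=
  [set S | open_packing S].

Definition open_packing_number (G : sgraph) : nat :=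
  \max_(S in open_packings G) #|S|.

Definition connected (G : sgraph) : Prop :=
  forall x y : G, connect (@edge G) x y.

Definition iso (G H : sgraph) : Prop :=
  exists2 f : G -> H, bijective f & {mono f : x y / edge x y}.

Section Induced.
Variables (G : sgraph) (S : {set G}).
Definition induced_edge : rel {x : G | x \in S} :=
  fun x y => edge (val x) (val y).
Lemma induced_sym : symmetric induced_edge.
Proof. by move=> x y; apply: edge_sym. Qed.
Lemma induced_irr : irreflexive induced_edge.
Proof. by move=> x; apply: edge_irr. Qed.
Definition induced : sgraph := SGraph induced_sym induced_irr.
End Induced.

Section Path.
Variable t : nat.
Definition path_edge : rel 'I_t := fun i j => (i.+1 == j) || (j.+1 == i).
Lemma path_sym : symmetric path_edge.
Proof. by move=> i j; apply: orbC. Qed.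
Lemma path_irr : irreflexive path_edge.
Proof. by move=> i; rewrite /path_edge orbb gtn_eqF. Qed.
Definition path_graph : sgraph := SGraph path_sym path_irr.
End Path.

Section Complete.
Variable t : nat.
Definition complete_edge : rel 'I_t := fun i j => i != j.
Lemma complete_sym : symmetric complete_edge.
Proof. by move=> i j; rewrite /complete_edge eq_sym. Qed.
Lemma complete_irr : irreflexive complete_edge.
Proof. by move=> i; rewrite /complete_edge eqxx. Qed.
Definition complete_graph : sgraph := SGraph complete_sym complete_irr.
End Complete.

Section Edgeless.
Variable r : nat.
Definition edgeless_edge : rel 'I_r := fun _ _ => false.
Lemma edgeless_sym : symmetric edgeless_edge. Proof. by []. Qed.
Lemma edgeless_irr : irreflexive edgeless_edge. Proof. by []. Qed.
Definition edgeless_graph : sgraph := SGraph edgeless_sym edgeless_irr.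
End Edgeless.

Section DisjointUnion.
Variables G H : sgraph.
Definition union_edge : rel (G + H) := fun u v =>
  match u, v with
  | inl x, inl y => edge x y
  | inr x, inr y => edge x y
  | _, _ => false
  end.
Lemma union_sym : symmetric union_edge.
Proof. by move=> [x|x] [y|y] //=; apply: edge_sym. Qed.
Lemma union_irr : irreflexive union_edge.
Proof. by move=> [x|x] /=; apply: edge_irr. Qed.
Definition disjoint_union : sgraph := SGraph union_sym union_irr.
End DisjointUnion.

Definition contains_induced (H G : sgraph) : Prop :=
  exists S : {set G}, iso (induced S) H.

Definition induced_free (H G : sgraph) : Prop := ~ contains_induced H G.

(* The model of computation is a random access machine in the style of Cook
   and Reckhow, with a one-way input tape and a one-way output tape of natural
   numbers, except that control flow is structured instead of given by jumps.
   Arithmetic is limited to addition and truncated subtraction, so charging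
   one unit per operation and per test defines the same polynomial time as
   Turing machines: t steps add at most t bits to the longest
   number occurring in the input or in the program. *)
Inductive prog :=
  | Skip
  | Imm (x c : nat)
  | Add (x y z : nat)
  | Sub (x y z : nat)
  | Fetch (x y : nat)
  | Store (x y : nat)
  | Input (x : nat)
  | Output (x : nat)
  | Seq (p q : prog)
  | If (x : nat) (p q : prog)
  | While (x : nat) (p : prog).

Record state := State {
  regs : nat -> nat;
  input : seq nat;
  output : seq nat }.

Definition set_reg (s : state) (x v : nat) : state :=
  State (fun i => if i == x then v else regs s i) (input s) (output s).

(* [exec p s t s']: started in [s], [p] halts in [s'] after exactly [t] steps. *)
Inductive exec : prog -> state -> nat -> state -> Prop :=
  | ExecSkip s : exec Skip s 1 s
  | ExecImm s x c : exec (Imm x c) s 1 (set_reg s x c)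
  | ExecAdd s x y z :
      exec (Add x y z) s 1 (set_reg s x (regs s y + regs s z))
  | ExecSub s x y z :
      exec (Sub x y z) s 1 (set_reg s x (regs s y - regs s z))
  | ExecFetch s x y : exec (Fetch x y) s 1 (set_reg s x (regs s (regs s y)))
  | ExecStore s x y : exec (Store x y) s 1 (set_reg s (regs s x) (regs s y))
  | ExecInput s x :
      exec (Input x) s 1
        (set_reg (State (regs s) (behead (input s)) (output s))
                 x (head 0 (input s)))
  | ExecOutput s x :
      exec (Output x) s 1
        (State (regs s) (input s) (rcons (output s) (regs s x)))
  | ExecSeq p q s1 t1 s2 t2 s3 :
      exec p s1 t1 s2 -> exec q s2 t2 s3 -> exec (Seq p q) s1 (t1 + t2) s3
  | ExecIfT x p q s t s' :
      0 < regs s x -> exec p s t s' -> exec (If x p q) s t.+1 s'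
  | ExecIfF x p q s t s' :
      regs s x = 0 -> exec q s t s' -> exec (If x p q) s t.+1 s'
  | ExecWhileT x p s1 t1 s2 t2 s3 :
      0 < regs s1 x -> exec p s1 t1 s2 -> exec (While x p) s2 t2 s3 ->
      exec (While x p) s1 (t1 + t2).+1 s3
  | ExecWhileF x p s : regs s x = 0 -> exec (While x p) s 1 s.

Definition runs (p : prog) (inp : seq nat) (t : nat) (out : seq nat) : Prop :=
  exists2 s, exec p (State (fun=> 0) inp [::]) t s & output s = out.

(* Vertices are numbered from 0 along [enum G]; a graph is presented to a
   program as its order followed by its adjacency matrix, row by row. *)
Definition encode_graph (G : sgraph) : seq nat :=
  #|G| :: [seq nat_of_bool (edge x y) | x <- enum G, y <- enum G].

Definition encode_set (G : sgraph) (S : {set G}) : seq nat :=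
  #|S| :: [seq nat_of_ord (enum_rank x) | x <- enum S].

(* No behaviour is required of the program on graphs outside the class. *)
Definition poly_time (C : sgraph -> Prop)
    (spec : forall G : sgraph, seq nat -> Prop) : Prop :=
  exists (p : prog) (b : {poly nat}), forall G : sgraph, C G ->
    exists t out,
      [/\ runs p (encode_graph G) t out, t <= b.[#|G|]%R & spec G out].

Definition few_open_packings (C : sgraph -> Prop) : Prop :=
  exists b : {poly nat}, forall G : sgraph, C G ->
    #|open_packings G| <= b.[#|G|]%R.

(* Every block of the output starts with its own length, so the list of sets
   can be read back from the concatenation; the order of the list is free. *)
Definition lists_open_packings (G : sgraph) (out : seq nat) : Prop :=
  exists ss : seq {set G},
    [/\ uniq ss, ss =i open_packings G & out = flatten (map (@encode_set G) ss)].

Definition outputs_open_packing_number (G : sgraph) (out : seq nat) : Prop :=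
  out = [:: open_packing_number G].

(* [H] is [F] together with isolated vertices.  On a disconnected [F]-free
   graph, all of which are [H]-free, every vertex subset may be an open packing:
   this happens on edgeless graphs, and for F = P_3, P_4 also on disjoint unions
   of edges.  Listing the open packings therefore excludes the disconnected
   [F]-free graphs and nothing else; computing the open packing number excludes
   no graph. *)
Definition enumerable_class (F H : sgraph) : sgraph -> Prop :=
  fun G => induced_free H G /\ (connected G \/ contains_induced F G).

(* Main.v *)
Require Import Defs.
From mathcomp Require Import all_boot all_algebra.
From mathcomp Require Import zify.
Set Implicit Arguments.
Unset Strict Implicit.
Unset Printing Implicit Defensive.

(* An open packing S induces a subgraph of maximum degree 1, so it contains
   |S|/2 independent vertices, and every vertex has at most one neighbour in
   it.  Hence, if G contains F but not F + rK_1, then |S| <= 2|F| + 2r.  In a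
   P_4-free graph two vertices of one component are equal, adjacent or have a
   common neighbour, so an open packing meets a component in at most two
   vertices, and in two only if they form a "good" edge, one without common
   neighbour of its ends.  So open packings have bounded size on every class to
   be listed, and an exhaustive search over increasing tuples lists them.
   On a P_4-free graph, exchanging the part of a maximum open packing in one
   component shows that the open packing number is the number of components
   plus the number of components with a good edge; both are counted by
   first-order formulas that single out the least vertex (with a good edge) of
   each component.  Whether G has an induced P_4 is also a first-order question,
   so all programs are written in a small language of first-order tests,
   searches and outputs, compiled to the machine in polynomial time. *)

Definition rk {G : sgraph} (x : G) : nat := enum_rank x.
Lemma rk_inj (G : sgraph) : injective (@rk G).
Proof. by move=> x y /val_inj /enum_rank_inj. Qed.

(** * Open packings *)

Definition meets (G : sgraph) (x y : G) := [exists z, edge x z && edge y z].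

Lemma meetsP (G : sgraph) (x y : G) :
  reflect (exists2 z, edge x z & edge y z) (meets x y).
Proof.
by apply: (iffP existsP) => [[z /andP[]]|[z xz yz]]; exists z => //; apply/andP.
Qed.

Lemma meets_sym (G : sgraph) : symmetric (@meets G).
Proof. by move=> x y; apply: eq_existsb => z; rewrite andbC. Qed.

Lemma open_packingP (G : sgraph) (S : {set G}) :
  reflect {in S &, forall x y, x != y -> ~~ meets x y} (open_packing S).
Proof.
have E x y : (neighbours x :&: neighbours y == set0) = ~~ @meets G x y.
  rewrite -[LHS]negbK; congr (~~ _); apply/set0Pn/meetsP => [[z]|[z xz yz]].
    by rewrite !inE => /andP[]; exists z.
  by exists z; rewrite !inE xz.
apply: (iffP forall_inP) => [SP x y Sx Sy xy|SP x Sx].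
  by rewrite -E; have /forall_inP/(_ y Sy)/implyP := SP x Sx; apply.
by apply/forall_inP => y Sy; apply/implyP; rewrite E; apply: SP.
Qed.

Lemma open_packing_uniq (G : sgraph) (S : {set G}) z :
  open_packing S -> {in S &, forall x y, edge z x -> edge z y -> x = y}.
Proof.
move=> /open_packingP SP x y Sx Sy zx zy; apply/eqP; apply: contraT => xy.
by case/meetsP: (SP x y Sx Sy xy); exists z; rewrite edge_sym.
Qed.

Lemma open_packing_sub (G : sgraph) (S T : {set G}) :
  T \subset S -> open_packing S -> open_packing T.
Proof.
move=> /subsetP TS /open_packingP SP; apply/open_packingP => x y Tx Ty.
by apply: SP; apply: TS.
Qed.

(** Picking for each such vertex a neighbour in [A] is injective, because no vertex has two
    neighbours in an open packing. *)
Lemma card_packed_neighbours (G : sgraph) (S A : {set G}) : open_packing S ->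
  #|[set y in S | [exists x in A, edge x y]]| <= #|A|.
Proof.
move=> SP; pose f y := odflt y [pick x in A | edge x y].
have fP y : y \in [set y in S | [exists x in A, edge x y]] ->
    [/\ y \in S, f y \in A & edge (f y) y].
  rewrite inE => /andP[Sy /existsP[x /andP[Ax xy]]]; rewrite /f.
  by case: pickP => [z /andP[]|/(_ x)] //; rewrite Ax xy.
rewrite -(card_in_imset (f := f)) => [|y z /fP[Sy Ay ey] /fP[Sz Az ez] yz].
  by apply/subset_leq_card/subsetP => _ /imsetP[y /fP[_ ? _] ->].
by apply: (open_packing_uniq SP Sy Sz ey); rewrite yz.
Qed.

Definition independent (G : sgraph) (I : {set G}) :=
  {in I &, forall x y, ~~ edge x y}.

(* A vertex of an open packing has at most one neighbour in it, so keeping the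
   smaller end of every edge keeps at least half of the vertices. *)
Lemma open_packing_independent (G : sgraph) (S : {set G}) : open_packing S ->
  exists I : {set G}, [/\ I \subset S, independent I & #|S| <= 2 * #|I|].
Proof.
move=> SP.
pose I := [set x in S | [forall y in S, edge x y ==> (rk x < rk y)]].
have IP x y : x \in I -> y \in S -> edge x y -> rk x < rk y.
  by rewrite inE => /andP[_ /forall_inP/(_ y) xP] Sy; apply/implyP/xP.
have IS : I \subset S by apply/subsetP => x; rewrite inE => /andP[].
exists I; split=> // [x y Ix Iy|].
  apply/negP => xy; have := IP x y Ix (subsetP IS y Iy) xy.
  by rewrite edge_sym in xy; have := IP y x Iy (subsetP IS x Ix) xy; lia.
rewrite -(cardsID I S) mul2n -addnn; apply: leq_add.
  by apply/subset_leq_card/subsetIr.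
(* Every discarded [y] has a neighbour in [I]: the vertex [z] that witnesses its rejection has [y]
   as its only neighbour in [S], so [z] itself is kept. *)
apply: leq_trans (card_packed_neighbours I SP).
apply/subset_leq_card/subsetP => y; rewrite !inE => /andP[].
case Sy: (y \in S) => //=; rewrite negb_forall_in => /exists_inP[z Sz].
rewrite negb_imply -leqNgt => /andP[yz zy] _.
apply/existsP; exists z; rewrite edge_sym yz andbT inE Sz /=.
apply/forall_inP => w Sw; apply/implyP => zw.
have -> : w = y by apply: (open_packing_uniq SP Sw Sy zw); rewrite edge_sym.
rewrite ltn_neqAle zy andbT; apply/eqP => /rk_inj zy'.
by rewrite zy' edge_irr in yz.
Qed.

(** * Induced subgraphs as embeddings, and size bounds from forbidden ones *)

Definition embedding (H G : sgraph) (f : H -> G) :=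
  injective f /\ {mono f : x y / edge x y}.

Lemma contains_inducedP (H G : sgraph) :
  contains_induced H G <-> exists f : H -> G, embedding f.
Proof.
split=> [[S [f [g fK gK] fE]]|[f [fI fE]]].
  exists (val \o g); split=> [|x y /=].
    exact: inj_comp val_inj (can_inj gK).
  by rewrite -{2}(gK x) -{2}(gK y) fE.
pose S := [set f x | x in [set: H]]; exists S.
have fS x : f x \in S by apply: imset_f.
pose g x : induced S := Sub (f x) (fS x).
have gI : injective g by move=> x y /(congr1 val)/fI.
have [|h gK hK] := inj_card_bij gI.
  by rewrite card_sig card_imset // cardsT.
exists h; first by exists g.
move=> x y; rewrite -[in RHS](hK x) -[in RHS](hK y); exact/esym/fE.
Qed.

Lemma independent_contains (G : sgraph) (I : {set G}) r : independent I ->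
  r <= #|I| -> contains_induced (edgeless_graph r) G.
Proof.
move=> II rI; apply/contains_inducedP.
exists (fun i : 'I_r => enum_val (widen_ord rI i)); split=> [i j|i j].
  by move=> /enum_val_inj [] /val_inj.
by apply/negbTE/II; apply: enum_valP.
Qed.

Lemma union_contains (F G : sgraph) (f : F -> G) (I : {set G}) r :
  embedding f -> independent I ->
  (forall x y, y \in I -> f x != y /\ ~~ edge (f x) y) ->
  r <= #|I| -> contains_induced (disjoint_union F (edgeless_graph r)) G.
Proof.
move=> [fI fE] II sep rI; apply/contains_inducedP.
pose g (u : disjoint_union F (edgeless_graph r)) := match u with
  | inl x => f x | inr i => enum_val (widen_ord rI i) end.
have gI i : g (inr i) \in I by apply: enum_valP.
exists g; split=> [[x|i] [y|j]|[x|i] [y|j]].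
- by move=> /fI ->.
- by move=> e; case: (sep x _ (gI j)); rewrite -e eqxx.
- by move=> e; case: (sep y _ (gI i)); rewrite e eqxx.
- by move=> /enum_val_inj [] /val_inj ->.
- exact: fE.
- by apply/negbTE; case: (sep x _ (gI j)).
- by rewrite edge_sym; apply/negbTE; case: (sep y _ (gI i)).
- by apply/negbTE/II; apply: gI.
Qed.

(** Deleting from [S] a copy of [F] and its neighbours costs at most [2 * #|F|] vertices. If more
    than [2 * r] vertices were left, an independent half of them would complete the copy to the
    forbidden graph. *)
Lemma card_open_packing_union_free (F G : sgraph) r (S : {set G}) :
  induced_free (disjoint_union F (edgeless_graph r)) G ->
  contains_induced F G -> open_packing S -> #|S| <= 2 * #|F| + 2 * r.
Proof.
move=> free /contains_inducedP[f fP] SP; rewrite leqNgt; apply/negP => big.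
pose P := [set f x | x in [set: F]].
pose N := [set y in S | [exists x in P, edge x y]].
have cP : #|P| = #|F| by rewrite card_imset ?cardsT //; case: fP.
have cN : #|N| <= #|F| by rewrite -cP; apply: card_packed_neighbours.
pose S' := S :\: (P :|: N).
have S'S : S' \subset S by apply: subsetDl.
have [I [/subsetP IS' II cI]] :=
  open_packing_independent (open_packing_sub S'S SP).
apply: free; apply: union_contains fP II _ _ => [x y /IS'|].
  rewrite !inE negb_or => /andP[/andP[Py Ny] Sy]; split.
    by apply: contraNneq Py => <-; apply: imset_f.
  apply: contra Ny => xy; rewrite Sy; apply/exists_inP; exists (f x) => //.
  exact: imset_f.
have := cardsID (P :|: N) S; rewrite -/S'.
have := subset_leq_card (subsetIr S (P :|: N)).
have := (leq_card_setU P N).1.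
lia.
Qed.

Lemma card_open_packing_edgeless_free (G : sgraph) r (S : {set G}) :
  induced_free (edgeless_graph r) G -> open_packing S -> #|S| <= 2 * r.
Proof.
move=> free /open_packing_independent[I [_ II cI]]; rewrite leqNgt.
by apply/negP => big; apply/free/(independent_contains II); lia.
Qed.

(** * Components of $P_4$-free graphs and their open packing number *)

Definition is_P4 (G : sgraph) (a b c d : G) :=
  [&& edge a b, edge b c, edge c d, ~~ edge a c, ~~ edge b d & ~~ edge a d].

Definition has_P4 (G : sgraph) :=
  [exists a : G, exists b : G, exists c : G, exists d : G, is_P4 a b c d].

(** The pattern of edges and non-edges forces the four vertices to be distinct, so the initial
    segments of the path embed all three graphs. *)
Lemma has_P4_contains (G : sgraph) : has_P4 G ->
  [/\ contains_induced (path_graph 4) G, contains_induced (path_graph 3) G &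
      contains_induced (complete_graph 2) G].
Proof.
case/existsP=> a /existsP[b /existsP[c /existsP[d]]].
case/and5P=> ab bc cd /negPf ac /andP[/negPf bd /negPf ad].
have ba : edge b a by rewrite edge_sym.
have cb : edge c b by rewrite edge_sym.
have dc : edge d c by rewrite edge_sym.
have ca : edge c a = false by rewrite edge_sym.
have db : edge d b = false by rewrite edge_sym.
have da : edge d a = false by rewrite edge_sym.
have nab : a <> b by move=> e; rewrite e edge_irr in ab.
have nbc : b <> c by move=> e; rewrite e edge_irr in bc.
have ncd : c <> d by move=> e; rewrite e edge_irr in cd.
have nac : a <> c by move=> e; rewrite e cd in ad.
have nbd : b <> d by move=> e; rewrite -e ab in ad.
have nad : a <> d by move=> e; rewrite -e ca in cd.
split; apply/contains_inducedP;
  exists (fun i => nth a [:: a; b; c; d] (val i)); split=> -[i ip] [j jp];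
  case: i ip => [|[|[|[|i]]]] // ip; case: j jp => [|[|[|[|j]]]] // jp;
  rewrite /= ?edge_irr // => e; by [apply: val_inj | congruence].
Qed.

(** Distance at most two. *)
Definition near (G : sgraph) (x y : G) := [|| x == y, edge x y | meets x y].

Lemma near_connect (G : sgraph) (x y : G) : near x y -> connect (@edge G) x y.
Proof.
case/or3P => [/eqP -> | xy | /meetsP[z xz yz]]; first exact: connect0.
  exact: connect1.
by apply: connect_trans (connect1 xz) (connect1 _); rewrite edge_sym.
Qed.

(** If [w] joins [x] to [y] and [z] is not near [x], then [x], [w], [y], [z] form an induced $P_4$:
    any further edge would bring [z] or [y] closer to [x], in the end giving [x] and [z] a common
    neighbour. *)
Lemma P4_free_near_edge (G : sgraph) (x y z : G) :
  ~~ has_P4 G -> near x y -> edge y z -> near x z.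
Proof.
move=> noP4 xy yz; apply: contraNT noP4 => nxz.
have /norP[xz /norP[exz mxz]] := nxz.
have zy : edge z y by rewrite edge_sym.
case/or3P: xy => [/eqP e|xy|/meetsP[w xw yw]].
- by rewrite e yz in exz.
- by case/meetsP: mxz; exists y.
have wy : edge w y by rewrite edge_sym.
apply/existsP; exists x; apply/existsP; exists w; apply/existsP; exists y.
apply/existsP; exists z; apply/and5P; split=> //.
- by apply: contra mxz => xy; apply/meetsP; exists y.
- rewrite exz andbT; apply: contra mxz => wz; apply/meetsP.
  by exists w; rewrite // edge_sym.
Qed.

(** Induction along a walk from [x]. Connectedness thereby becomes a first-order relation, which a
    program can test. *)
Lemma P4_free_near (G : sgraph) (x y : G) :
  ~~ has_P4 G -> near x y = connect (@edge G) x y.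
Proof.
move=> noP4; apply/idP/idP; first exact: near_connect.
case/connectP=> p; elim/last_ind: p y => [|p z IH] y /=.
  by move=> _ ->; rewrite /near eqxx.
rewrite rcons_path last_rcons => /andP[xp pz] ->.
by apply: P4_free_near_edge noP4 _ pz; apply: IH.
Qed.

Lemma edge_connect_sym (G : sgraph) : connect_sym (@edge G).
Proof. by apply: sym_connect_sym; apply: edge_sym. Qed.

Definition good_edge (G : sgraph) (x y : G) := edge x y && ~~ meets x y.

Lemma P4_free_good_edge (G : sgraph) (S : {set G}) : ~~ has_P4 G ->
  open_packing S ->
  {in S &, forall x y, x != y -> connect (@edge G) x y -> good_edge x y}.
Proof.
move=> noP4 /open_packingP SP x y Sx Sy xy; rewrite -P4_free_near // /near.
by rewrite /good_edge (negPf xy) (negPf (SP x y Sx Sy xy)) orbF andbT.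
Qed.

(** Three members would be pairwise adjacent, making one of them a common neighbour of the other
    two. *)
Lemma P4_free_component_card (G : sgraph) (S : {set G}) : ~~ has_P4 G ->
  open_packing S -> {in S &, forall x y, connect (@edge G) x y} -> #|S| <= 2.
Proof.
move=> noP4 SP Sc; rewrite leqNgt.
apply/card_gt2P => -[x [y [z [[Sx Sy Sz] [xy yz zx]]]]].
have [|xz _] := andP (P4_free_good_edge noP4 SP Sx Sz _ (Sc _ _ Sx Sz)).
  by rewrite eq_sym.
have [yz' _] := andP (P4_free_good_edge noP4 SP Sy Sz yz (Sc _ _ Sy Sz)).
have [_] := andP (P4_free_good_edge noP4 SP Sx Sy xy (Sc _ _ Sx Sy)).
by case/meetsP; exists z.
Qed.

Lemma open_packing_number_ge (G : sgraph) (S : {set G}) :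
  open_packing S -> #|S| <= open_packing_number G.
Proof.
by move=> SP; apply: (leq_bigmax_cond (P := [in open_packings G])); rewrite inE.
Qed.

Lemma open_packing_number_attained (G : sgraph) :
  exists2 S : {set G}, open_packing S & #|S| = open_packing_number G.
Proof.
have [|S] := @eq_bigmax_cond _ [in open_packings G] (fun S => #|S|).
  apply/card_gt0P; exists set0; rewrite !inE; apply/open_packingP => x y.
  by rewrite inE.
by rewrite !inE => SP E; exists S; rewrite // -E.
Qed.

(* The least vertex satisfying [Q] in each component, provided that nearness
   is connectedness. *)
Definition firsts (G : sgraph) (Q : pred G) :=
  [set x | Q x && ~~ [exists y, [&& rk y < rk x, near x y & Q y]]].

(** Empty unless [c] is the representative chosen by [root], so a sum over all vertices [c] is a sum
    over the components. *)
Definition component (G : sgraph) (c : G) :=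
  [set x | fingraph.root (@edge G) x == c].

Lemma card_components (G : sgraph) (A : {set G}) :
  #|A| = \sum_(c : G) #|A :&: component c|.
Proof.
rewrite -sum1_card (partition_big (fingraph.root (@edge G)) predT) //=.
apply: eq_bigr => c _; rewrite sum1_card; apply: eq_card => x.
by rewrite !inE.
Qed.

(** All vertices of a component are near each other, so [firsts] keeps only the least one satisfying
    [Q], if any. The right-hand side is a boolean read as 0 or 1. *)
Lemma card_firsts_component (G : sgraph) (Q : pred G) (c : G) : ~~ has_P4 G ->
  #|firsts Q :&: component c| = [exists x in component c, Q x].
Proof.
move=> noP4.
have nearE x y : x \in component c -> near x y = (y \in component c).
  rewrite !inE P4_free_near // => /eqP <-.
  by rewrite -(root_connect (@edge_connect_sym G)) eq_sym.
case: exists_inP => [[x0 cx0 Qx0]|noQ].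
  pose P x := (x \in component c) && Q x.
  have Px0 : P x0 by apply/andP.
  case: (arg_minnP (@rk G) Px0) => x /andP[cx Qx] xmin.
  suff -> : firsts Q :&: component c = [set x] by rewrite cards1.
  apply/setP => y; rewrite in_setI in_set1 [y \in firsts Q]inE.
  apply/idP/eqP => [/andP[/andP[Qy ymin] cy]|->].
    apply: rk_inj; apply/eqP; rewrite eqn_leq xmin /P ?cy ?Qy // andbT.
    rewrite leqNgt; apply: contra ymin => xy; apply/existsP; exists x.
    by rewrite xy nearE // cx.
  rewrite Qx cx andbT /=; apply/existsP => -[z /and3P[zx]].
  rewrite nearE // => cz Qz; have := xmin z; rewrite /P cz Qz => /(_ isT).
  by rewrite leqNgt zx.
apply: eq_card0 => x; rewrite in_setI inE; apply/negbTE/negP.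
by case/andP => /andP[Qx _] cx; case: noQ; exists x.
Qed.

(** Vertices of different components have no common neighbour, so replacing the part of [S] in the
    component by [T] gives an open packing, which cannot be larger than [S]. *)
Lemma exchange_component (G : sgraph) (S T : {set G}) c : open_packing S ->
  #|S| = open_packing_number G -> open_packing T -> T \subset component c ->
  #|T| <= #|S :&: component c|.
Proof.
move=> /open_packingP SP Smax /open_packingP TP /subsetP Tc.
have sep x y : x \notin component c -> y \in component c -> ~~ meets x y.
  rewrite !inE => xc yc; apply: contraNN xc => xy.
  rewrite -(eqP yc) (root_connect (@edge_connect_sym G)).
  by apply: near_connect; rewrite /near xy !orbT.
have UP : open_packing (T :|: S :\: component c).
  apply/open_packingP => x y; rewrite !in_setU !in_setD.
  case/orP=> [Tx|/andP[nx Sx]] /orP[Ty|/andP[ny Sy]] xy.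
  - exact: TP.
  - by rewrite meets_sym; apply: sep ny (Tc x Tx).
  - by apply: sep nx (Tc y Ty).
  - exact: SP.
have := open_packing_number_ge UP; rewrite -Smax cardsU.
rewrite -(cardsID (component c) S).
suff -> : T :&: (S :\: component c) = set0 by rewrite cards0; lia.
apply/setP => x; rewrite in_setI in_setD in_set0; apply/negbTE/negP.
by case/and3P=> /Tc ->.
Qed.

Lemma open_packing1 (G : sgraph) (x : G) : open_packing [set x].
Proof.
by apply/open_packingP => y z /set1P-> /set1P->; rewrite eqxx.
Qed.

Lemma open_packing2 (G : sgraph) (x y : G) :
  good_edge x y -> open_packing [set x; y].
Proof.
case/andP=> _ xy; apply/open_packingP => u v /set2P[]-> /set2P[]->;
  by rewrite ?eqxx // meets_sym.
Qed.

Definition in_good_edge (G : sgraph) : pred G :=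
  fun x => [exists y, good_edge x y].

(** The two sides agree on each component. A maximum open packing has at most two vertices there;
    exchange with the ends of a good edge yields two, and exchange with a single vertex yields
    one. *)
Lemma P4_free_open_packing_number (G : sgraph) : ~~ has_P4 G ->
  open_packing_number G =
  #|firsts (@predT G)| + #|firsts (@in_good_edge G)|.
Proof.
move=> noP4; have [S SP Smax] := open_packing_number_attained G.
rewrite -Smax !card_components -big_split /=; apply: eq_bigr => c _.
rewrite !card_firsts_component //.
have SI : open_packing (S :&: component c).
  exact: open_packing_sub (subsetIl _ _) SP.
have con : {in S :&: component c &, forall x y, connect (@edge G) x y}.
  move=> x y; rewrite !inE => /andP[_ /eqP <-] /andP[_ xy].
  by rewrite -(root_connect (@edge_connect_sym G)) eq_sym.
have one : #|S :&: component c| > 1 ->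
    [exists x in component c, in_good_edge x].
  case/card_gt1P=> x [y [Sx Sy xy]]; apply/exists_inP; exists x.
    by move: Sx; rewrite inE => /andP[].
  apply/existsP; exists y.
  by apply: (P4_free_good_edge noP4 SI) => //; apply: con.
have le2 := P4_free_component_card noP4 SI con.
case: exists_inP one => [[x cx /existsP[y xy]] _|_ one].
  have xy' : x != y.
    by apply: contraTneq xy => ->; rewrite /good_edge edge_irr.
  have : #|[set x; y]| <= #|S :&: component c|.
    apply: exchange_component SP Smax (open_packing2 xy) _.
    rewrite subUset !sub1set cx inE.
    move: cx; rewrite inE => /eqP <-.
    rewrite (root_connect (@edge_connect_sym G)) edge_connect_sym.
    by apply: connect1; case/andP: xy.
  rewrite cards2 xy'; suff -> : [exists x in component c, predT x] by lia.
  by apply/exists_inP; exists x.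
have {one} : #|S :&: component c| <= 1 by rewrite leqNgt; apply/negP => /one.
case: exists_inP => [[x cx _]|no].
  have := exchange_component SP Smax (open_packing1 x).
  by rewrite cards1 => /(_ c); rewrite sub1set cx => /(_ isT); lia.
(* Here [c] represents no component, and both sides vanish. *)
move=> _; apply: eq_card0 => x; apply/negbTE/negP; rewrite inE => /andP[_ cx].
by case: no; exists x.
Qed.

(** * Bounded size and polynomial number of open packings *)

Lemma card_open_packing_connected (G : sgraph) (S : {set G}) :
  connected G -> ~~ has_P4 G -> open_packing S -> #|S| <= 2.
Proof. by move=> Gc noP4 SP; apply: P4_free_component_card. Qed.

(** The constant 8 is twice the bound on [#|F|]. A graph of the class that does not contain [F] is
    connected and has no induced $P_4$, so the bound for one component applies. *)
Lemma card_open_packing_enumerable (F : sgraph) r (G : sgraph) (S : {set G}) :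
  #|F| <= 4 -> (has_P4 G -> contains_induced F G) ->
  enumerable_class F (disjoint_union F (edgeless_graph r)) G ->
  open_packing S -> #|S| <= 2 * r + 8.
Proof.
move=> F4 P4F [free disj] SP.
have bound : contains_induced F G -> #|S| <= 2 * r + 8.
  by move=> cF; have := card_open_packing_union_free free cF SP; lia.
case: disj => // Gc; case: (boolP (has_P4 G)) => [/P4F //|noP4].
by have := card_open_packing_connected Gc noP4 SP; lia.
Qed.

(** Sort the open packings by size: at most $n^k$ vertex sets have size $k$, since a binomial
    coefficient is at most the falling factorial and hence the power. *)
Lemma few_open_packings_bounded (C : sgraph -> Prop) K :
  (forall G, C G -> forall S : {set G}, open_packing S -> #|S| <= K) ->
  few_open_packings C.
Proof.
move=> CK; exists (\sum_(k < K.+1) 'X^k)%R => G CG.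
pose size_of (S : {set G}) : 'I_K.+1 := inord #|S|.
rewrite horner_sum -sum1_card (partition_big size_of predT) //=.
apply: leq_sum => k _; rewrite hornerXn sum1_card.
apply: (@leq_trans #|[set A : {set G} | #|A| == k]|).
  apply/subset_leq_card/subsetP => S; rewrite !inE => /andP[SP /eqP <-].
  by rewrite inE in SP; rewrite inordK // ltnS (CK G).
rewrite card_draws.
apply: leq_trans (_ : #|G| ^_ k <= _).
  by rewrite -bin_ffact leq_pmulr ?fact_gt0.
elim: (nat_of_ord k) => // j IH; rewrite ffactnSr GRing.exprSr.
exact: (leq_mul IH (leq_subr _ _)).
Qed.

(** * A language of first-order tests and searches *)

(* Variables are numbered by the depth of their binder.  A command succeeds or
   fails: [Ex c] tries the values of a new variable in turn until [c] succeeds,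
   without undoing the effects of the failed attempts, so it is a [for] loop
   when [c] always fails. *)
Inductive cmd :=
  | Ret (b : bool)
  | Adj (x y : nat)
  | Lt (x y : nat)
  | Cond (c c1 c2 : cmd)
  | Ex (c : cmd)
  | Out (x : nat)
  | Print (k : nat)
  | Inc
  | PrintCount.

Section First.
Variables (A B : Type) (f : A -> B -> bool * B).

Fixpoint first (s : seq A) (g : B) : bool * B :=
  if s is a :: s' then
    let r := f a g in if r.1 then r else first s' r.2
  else (false, g).

Lemma first_cat s1 s2 g :
  first (s1 ++ s2) g =
  let r := first s1 g in if r.1 then r else first s2 r.2.
Proof. by elim: s1 g => //= a s1 IH g; case E: (f a g).1; rewrite /= ?E. Qed.

Lemma first_pure p : (forall a g, f a g = (p a, g)) ->
  forall s g, first s g = (has p s, g).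
Proof.
move=> fE; elim=> //= a s IH g; rewrite fE /=.
by case: (p a) => //=; rewrite IH.
Qed.
End First.

Lemma eq_in_first (A : eqType) B (f1 f2 : A -> B -> bool * B) s g :
  {in s, forall a g, f1 a g = f2 a g} -> first f1 s g = first f2 s g.
Proof.
elim: s g => //= a s IH g eqf; rewrite eqf ?mem_head //.
by case: ifP => // _; apply: IH => b sb; apply: eqf; rewrite inE sb orbT.
Qed.

Lemma first_map (A A' B : Type) (h : A' -> A) (f : A -> B -> bool * B) s g :
  first f (map h s) g = first (fun a => f (h a)) s g.
Proof. by elim: s g => //= a s IH g; case: ifP. Qed.

(** Nested searches with a guard amount to one search through a flattened list; this turns nested
    loops into an enumeration of tuples. *)
Lemma first_flatten (A A' B : Type) (f : A -> B -> bool * B) (h : A' -> seq A)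
    (p : pred A') s g :
  first f (flatten [seq h a | a <- s & p a]) g =
  first (fun a g => if p a then first f (h a) g else (false, g)) s g.
Proof.
elim: s g => //= a s IH g; case: ifP => //= pa; by rewrite first_cat /= IH.
Qed.

Lemma first_append A B C (f : A -> seq B) s (g : seq B * C) :
  first (fun a g => (false, (g.1 ++ f a, g.2))) s g =
  (false, (g.1 ++ flatten (map f s), g.2)).
Proof.
elim: s g => [|a s IH] g /=; first by rewrite cats0; case: g.
by rewrite IH /= catA.
Qed.

Section Semantics.
Variables (n : nat) (m : seq nat).

(** The output so far and the counter, the only things that a command can change. *)
Definition ghost := (seq nat * nat)%type.

Fixpoint run (c : cmd) (env : seq nat) (g : ghost) : bool * ghost :=
  match c with
  | Ret b => (b, g)
  | Adj x y => (0 < nth 0 m (nth 0 env x * n + nth 0 env y), g)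
  | Lt x y => (nth 0 env x < nth 0 env y, g)
  | Cond c c1 c2 =>
      let r := run c env g in if r.1 then run c1 env r.2 else run c2 env r.2
  | Ex c => first (fun i => run c (rcons env i)) (iota 0 n) g
  | Out x => (true, (rcons g.1 (nth 0 env x), g.2))
  | Print k => (true, (rcons g.1 k, g.2))
  | Inc => (true, (g.1, g.2.+1))
  | PrintCount => (true, (rcons g.1 g.2, g.2))
  end.
End Semantics.

(** * Compilation to the machine *)

Local Notation rN := 0.
Local Notation rR := 2.
Local Notation rT := 4.
Local Notation rOne := 6.
Local Notation rNN := 8.
Local Notation rCount := 10.
Local Notation rP := 12.
Local Notation rQ := 14.
(* Entry [k] of the adjacency matrix is stored in register [2 * k + 1], so that
   any number of variables fits in the even registers.  Register [row_reg x]
   holds [2 * n] times the value of variable [x], because the machine has no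
   multiplication; both registers of an unbound variable are 0. *)
Definition val_reg x := 16 + 4 * x.
Definition row_reg x := 18 + 4 * x.

(** In a loop [rT] holds the number of values left. The body may overwrite it, so after a failure it
    is recomputed from the loop variable; a success sets it to 0. The first instruction of a loop
    gives the answer when there are no values to try. *)
Fixpoint compile (d : nat) (c : cmd) : prog :=
  match c with
  | Ret b => Imm rR b
  | Adj x y =>
      Seq (Add rT (row_reg x) (val_reg y))
     (Seq (Add rT rT (val_reg y)) (Seq (Add rT rT rOne) (Fetch rR rT)))
  | Lt x y => Defs.Sub rR (val_reg y) (val_reg x)
  | Cond c c1 c2 =>
      Seq (compile d c) (If rR (compile d c1) (compile d c2))
  | Ex c =>
      Seq (Imm rR 0)
     (Seq (Defs.Sub rT rN (val_reg d))
     (Seq (While rT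
            (Seq (compile d.+1 c)
                 (If rR (Imm rT 0)
                    (Seq (Add (val_reg d) (val_reg d) rOne)
                    (Seq (Add (row_reg d) (row_reg d) rNN)
                         (Defs.Sub rT rN (val_reg d)))))))
     (Seq (Imm (val_reg d) 0) (Imm (row_reg d) 0))))
  | Out x => Seq (Output (val_reg x)) (Imm rR 1)
  | Print k => Seq (Imm rR k) (Seq (Output rR) (Imm rR 1))
  | Inc => Seq (Add rCount rCount rOne) (Imm rR 1)
  | PrintCount => Seq (Output rCount) (Imm rR 1)
  end.

Fixpoint cost (c : cmd) : {poly nat} :=
  match c with
  | Ret _ | Lt _ _ => 1%:P
  | Adj _ _ => 4%:P
  | Cond c c1 c2 => cost c + cost c1 + cost c2 + 1%:P
  | Ex c => (cost c + 5%:P) * 'X + 5%:P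
  | Print _ => 3%:P
  | Out _ | Inc | PrintCount => 2%:P
  end%R.

(** The invariant between commands. The default of [nth] expresses that unbound variables have both
    registers equal to 0. *)
Record holds (n : nat) (m env : seq nat) (s : state) : Prop := Holds {
  holdsN : regs s rN = n;
  holdsOne : regs s rOne = 1;
  holdsNN : regs s rNN = n + n;
  holdsM : forall k, regs s (2 * k).+1 = nth 0 m k;
  holdsV : forall x, regs s (val_reg x) = nth 0 env x;
  holdsW : forall x, regs s (row_reg x) = 2 * (nth 0 env x * n) }.

Definition ghost_of (s : state) : ghost := (output s, regs s rCount).

Definition result (r : bool * ghost) (s : state) : Prop :=
  (0 < regs s rR) = r.1 /\ ghost_of s = r.2.

Lemma holds_scratch n m env s s' :
  holds n m env s ->
  (forall x, x \notin [:: rR; rT; rCount; rP; rQ] -> regs s' x = regs s x) ->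
  holds n m env s'.
Proof.
case=> hN h1 hNN hM hV hW eqs; split=> [|||k|x|x]; rewrite eqs ?hN ?h1 ?hNN //;
  by rewrite !inE /val_reg /row_reg; lia.
Qed.

Ltac frame :=
  let y := fresh in let Hy := fresh in
  move=> y; rewrite !inE => Hy /=; repeat case: eqP => // ?; lia.

Lemma holds_var n m env i j s s' :
  holds n m (rcons env i) s ->
  (forall x, x \notin [:: rR; rT; val_reg (size env); row_reg (size env)] ->
     regs s' x = regs s x) ->
  regs s' (val_reg (size env)) = j ->
  regs s' (row_reg (size env)) = 2 * (j * n) ->
  holds n m (rcons env j) s'.
Proof.
case=> hN h1 hNN hM hV hW eqs hj hjn.
have E x : x <> size env -> nth 0 (rcons env j) x = nth 0 (rcons env i) x.
  by rewrite !nth_rcons; case: ltngtP.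
have E' : nth 0 (rcons env j) (size env) = j by rewrite nth_rcons ltnn eqxx.
split=> [|||k|x|x]; try by rewrite eqs // !inE /val_reg /row_reg; lia.
- case: (x =P size env) => [->|xd]; first by rewrite E'.
  by rewrite E // eqs // !inE /val_reg /row_reg; lia.
- case: (x =P size env) => [->|xd]; first by rewrite E'.
  by rewrite E // eqs // !inE /val_reg /row_reg; lia.
Qed.

(** Entering or leaving a scope in which the new variable is 0 changes nothing in the registers. *)
Lemma holds_rcons0 n m env s : holds n m (rcons env 0) s <-> holds n m env s.
Proof.
have E x : nth 0 (rcons env 0) x = nth 0 env x.
  rewrite nth_rcons; case: ltngtP => // [?|->]; rewrite nth_default //.
  exact: ltnW.
by split; case=> ? ? ? ? hV hW; split=> // x; rewrite ?hV ?hW E.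
Qed.

Lemma exec_time p s t t' s' : exec p s t s' -> t = t' -> exec p s t' s'.
Proof. by move=> ? <-. Qed.

Lemma compileP n m c env s : holds n m env s ->
  exists t s',
    [/\ exec (compile (size env) c) s t s', t <= (cost c).[n]%R,
        holds n m env s' & result (run n m c env (ghost_of s)) s'].
Proof.
elim: c env s => [b|x y|x y|c IHc c1 IH1 c2 IH2|c IHc|x|k||] env s H /=.
- exists 1, (set_reg s rR b); rewrite hornerC; split=> //.
  + exact: ExecImm.
  + by apply: holds_scratch H _; frame.
  + by split=> //=; case: b.
- exists 4; eexists; rewrite hornerC; split=> //.
  + by apply: exec_time; first do ?econstructor.
  + by apply: holds_scratch H _; frame.
  + split=> //=; case: H => hN h1 hNN hM hV hW.
    rewrite h1 hV hW.
    have -> : 2 * (nth 0 env x * n) + nth 0 env y + nth 0 env y + 1 =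
              (2 * (nth 0 env x * n + nth 0 env y)).+1 by lia.
    case: eqP => [|_]; first by lia.
    by rewrite hM.
- exists 1; eexists; rewrite hornerC; split=> //.
  + exact: ExecSub.
  + by apply: holds_scratch H _; frame.
  + by split=> //=; rewrite !(holdsV H) subn_gt0.
- have [t [s1 [e1 l1 H1 [r1 g1]]]] := IHc _ _ H.
  rewrite -g1; case: ifP r1 => _ r1.
    have [t2 [s2 [e2 l2 H2 r2]]] := IH1 _ _ H1.
    exists (t + t2.+1), s2; split=> //; last by rewrite !hornerD hornerC; lia.
    by apply: ExecSeq e1 _; apply: ExecIfT.
  have [t2 [s2 [e2 l2 H2 r2]]] := IH2 _ _ H1.
  exists (t + t2.+1), s2; split=> //; last by rewrite !hornerD hornerC; lia.
  by apply: ExecSeq e1 _; apply: ExecIfF => //; lia.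
- set f := fun i => run n m c (rcons env i).
  set d := size env; set body := While _ _.
  (* The value being tried is [i], and [k] values are left. The value [j] at exit depends on where
     the search stopped, and is forgotten because both registers are cleared afterwards. *)
  have loop k i s1 : i + k = n -> holds n m (rcons env i) s1 ->
      regs s1 rT = k -> regs s1 rR = 0 ->
    exists t s', [/\ exec body s1 t s', t <= ((cost c).[n]%R + 5) * k + 1,
      exists j, holds n m (rcons env j) s' &
      result (first f (iota i k) (ghost_of s1)) s'].
    elim: k i s1 => [|k IHk] i s1 ik H1 T1 R1 /=.
      exists 1, s1; split; rewrite ?muln0 //; first exact: ExecWhileF.
        by exists i.
      by split=> //=; rewrite R1.
    have [t [s2 [e2 l2 H2 [r2 g2]]]] := IHc _ _ H1.
    rewrite size_rcons -/d in e2.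
    rewrite -[f i _]/(run _ _ _ _ _) -g2; case: ifP (r2) => _ r2'.
      (* Success: two steps clear [rT], one ends the loop, and [rR] stays positive. *)
      exists (t + 2 + 1).+1, (set_reg s2 rT 0); split.
      + apply: ExecWhileT; first by rewrite T1.
          apply: (ExecSeq e2); apply: ExecIfT => //; exact: ExecImm.
        exact: ExecWhileF.
      + by lia.
      + by exists i; apply: holds_scratch H2 _; frame.
      + by split.
    (* Failure: the variable, its row offset and the number of values left are updated in turn. *)
    pose s3 := set_reg s2 (val_reg d) i.+1.
    pose s4 := set_reg s3 (row_reg d) (2 * (i.+1 * n)).
    pose s5 := set_reg s4 rT k.
    have H5 : holds n m (rcons env i.+1) s5.
      apply: holds_var H2 _ _ _; rewrite -/d /=.
      + by move=> y; rewrite !inE => Hy /=; repeat case: eqP => // ?; lia.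
      + by rewrite /val_reg /row_reg; repeat case: eqP => //; lia.
      + by rewrite /val_reg /row_reg; repeat case: eqP => //; lia.
    have [|//||t' [s' [e' l' [j Hj] r']]] := IHk i.+1 s5 _ H5.
    + by lia.
    + by rewrite /= /val_reg /row_reg; repeat case: eqP => // *; lia.
    exists (t + 4 + t').+1, s'; split.
    + apply: ExecWhileT e'; first by rewrite T1.
      apply: (ExecSeq e2); apply: ExecIfF; first by lia.
      have V2 := holdsV H2 d; have W2 := holdsW H2 d.
      rewrite nth_rcons ltnn eqxx in V2, W2.
      apply: (@ExecSeq _ _ _ 1 s3 2 _).
        by have := ExecAdd s2 (val_reg d) (val_reg d) rOne;
          rewrite (holdsOne H2) V2 addn1.
      apply: (@ExecSeq _ _ _ 1 s4 1 _).
        have := ExecAdd s3 (row_reg d) (row_reg d) rNN.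
        rewrite (_ : regs s3 _ + _ = 2 * (i.+1 * n)) //=.
        rewrite /val_reg /row_reg; repeat case: eqP => [|_]; try lia.
        by rewrite -/(row_reg d) W2 (holdsNN H2); lia.
      have := ExecSub s4 rT rN (val_reg d).
      rewrite (_ : regs s4 _ - _ = k) //=.
      rewrite /val_reg /row_reg; repeat case: eqP => [|_] //; try lia.
      by rewrite (holdsN H2); lia.
    + by lia.
    + by exists j.
    + rewrite -(_ : ghost_of s5 = ghost_of s2) // /ghost_of /=.
  pose s1 := set_reg (set_reg s rR 0) rT n.
  have H1 : holds n m (rcons env 0) s1.
    by apply/holds_rcons0; apply: holds_scratch H _; frame.
  have [//|//|//|t [s2 [e2 l2 [j Hj] [r2 g2]]]] := loop n 0 s1 _ H1.
  exists (1 + (1 + (t + 2))).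
  exists (set_reg (set_reg s2 (val_reg d) 0) (row_reg d) 0).
  split.
  + apply: ExecSeq; first exact: ExecImm.
    apply: (@ExecSeq _ _ _ _ s1).
      have := ExecSub (set_reg s rR 0) rT rN (val_reg d).
      by rewrite /= (holdsN H) (holdsV H) nth_default // subn0.
    apply: ExecSeq e2 _.
    apply: (@ExecSeq _ _ _ 1 _ 1); exact: ExecImm.
  + rewrite !(hornerD, hornerM, hornerX, hornerC).
    rewrite -[X in _ <= X]/(((cost c).[n]%R + 5) * n + 5); lia.
  + apply/holds_rcons0; apply: holds_var Hj _ _ _; rewrite -/d /=.
    * by move=> y; rewrite !inE => Hy /=; repeat case: eqP => // ?; lia.
    * by rewrite /val_reg /row_reg; repeat case: eqP => //; lia.
    * by rewrite eqxx.
  + split; rewrite -?r2 -?g2 /ghost_of /= /val_reg /row_reg.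
      by repeat case: eqP => [|_] //; lia.
    by congr (_, _); repeat case: eqP => [|_] //; lia.
- exists 2; eexists; rewrite hornerC; split=> //.
  + by apply: exec_time; first do ?econstructor.
  + by apply: holds_scratch H _; frame.
  + by split=> //=; rewrite /ghost_of /= (holdsV H).
- exists 3; eexists; rewrite hornerC; split=> //.
  + by apply: exec_time; first do ?econstructor.
  + by apply: holds_scratch H _; frame.
  + by split.
- exists 2; eexists; rewrite hornerC; split=> //.
  + by apply: exec_time; first do ?econstructor.
  + by apply: holds_scratch H _; frame.
  + by split=> //=; rewrite /ghost_of /= (holdsOne H) addn1.
- exists 2; eexists; rewrite hornerC; split=> //.
  + by apply: exec_time; first do ?econstructor.
  + by apply: holds_scratch H _; frame.
  + by split.
Qed.

(** * Reading the adjacency matrix *)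

Section Reading.
Variables (n : nat) (m : seq nat).

(** The first [j] entries are stored and [rP] points to the next odd register. Beyond [take j m] the
    default 0 matches registers not yet written. *)
Definition reading (j : nat) (s : state) : Prop :=
  [/\ [/\ regs s rN = n, regs s rOne = 1, regs s rNN = n + n &
          regs s rP = (2 * j).+1],
      forall k, regs s (2 * k).+1 = nth 0 (take j m) k,
      forall x, regs s (val_reg x) = 0,
      forall x, regs s (row_reg x) = 0 &
      [/\ input s = drop j m, output s = [::] & regs s rCount = 0]].

Lemma reading_scratch j s s' : reading j s ->
  (forall x, x \notin [:: rR; rT; rQ] -> regs s' x = regs s x) ->
  input s' = input s -> output s' = output s -> reading j s'.
Proof.
move=> [[hN h1 hNN hP] hM hV hW [hi ho hC]] eqs ei eo.
split; [split|move=> k|move=> x|move=> x|split];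
  rewrite ?ei ?eo ?eqs ?hN ?h1 ?hNN //;
  by rewrite !inE /val_reg /row_reg; lia.
Qed.

Lemma reading_step j s s' : reading j s ->
  (forall x, x \notin [:: rR; rT; rP; rQ; (2 * j).+1] ->
     regs s' x = regs s x) ->
  regs s' (2 * j).+1 = head 0 (input s) -> regs s' rP = (2 * j.+1).+1 ->
  input s' = behead (input s) -> output s' = output s -> reading j.+1 s'.
Proof.
move=> [[hN h1 hNN hP] hM hV hW [hi ho hC]] eqs eM eP ei eo.
split; [split|move=> k|move=> x|move=> x|split];
  rewrite ?ei ?eo //; try by rewrite eqs // !inE /val_reg /row_reg; lia.
- case: (ltngtP k j) => [kj|jk|->].
  + by rewrite eqs ?hM ?nth_take //; [exact: ltnW | rewrite !inE; lia].
  + have take0 i : i <= k -> nth 0 (take i m) k = 0.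
      by move=> ik; rewrite nth_default // size_take_min geq_min ik.
    rewrite eqs; last by rewrite !inE; lia.
    by rewrite hM !take0 // ltnW.
  + by rewrite eM hi nth_take // -nth0 nth_drop addn0.
- by rewrite hi -drop1 drop_drop.
Qed.

Definition read_row : prog :=
  While rT
    (Seq (Input rR) (Seq (Store rP rR) (Seq (Add rP rP rOne)
    (Seq (Add rP rP rOne) (Defs.Sub rT rT rOne))))).

(** Five instructions and one test per entry. The counter [rQ] of the enclosing loop must
    survive. *)
Lemma read_rowP k j s : reading j s -> regs s rT = k ->
  exists t s', [/\ exec read_row s t s', t <= 6 * k + 1,
    reading (j + k) s' & regs s' rQ = regs s rQ].
Proof.
elim: k j s => [|k IHk] j s H T.
  by exists 1, s; rewrite addn0; split=> //; apply: ExecWhileF.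
have [[hN h1 hNN hP] hM hV hW [hi ho hC]] := H.
pose s1 := set_reg (State (regs s) (behead (input s)) (output s)) rR
                   (head 0 (input s)).
pose s2 := set_reg s1 (2 * j).+1 (head 0 (input s)).
pose s3 := set_reg s2 rP (2 * j).+2.
pose s4 := set_reg s3 rP (2 * j).+3.
pose s5 := set_reg s4 rT k.
have H5 : reading j.+1 s5.
  apply: reading_step H _ _ _ _ _ => //=.
  + by move=> y; rewrite !inE => Hy; repeat case: eqP => // ?; lia.
  + by repeat case: eqP => //; lia.
  + by lia.
have [//|t [s' [e l H' Q]]] := IHk _ _ H5.
have x1 : exec (Input rR) s 1 s1 by exact: ExecInput.
have x2 : exec (Store rP rR) s1 1 s2.
  by have := ExecStore s1 rP rR; rewrite /= hP.
have x3 : exec (Add rP rP rOne) s2 1 s3.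
  have := ExecAdd s2 rP rP rOne; rewrite (_ : regs s2 _ + _ = (2 * j).+2) //=.
  by rewrite hP h1; repeat case: eqP => [|_]; lia.
have x4 : exec (Add rP rP rOne) s3 1 s4.
  have := ExecAdd s3 rP rP rOne; rewrite (_ : regs s3 _ + _ = (2 * j).+3) //=.
  by rewrite h1; repeat case: eqP => [|_]; lia.
have x5 : exec (Defs.Sub rT rT rOne) s4 1 s5.
  have := ExecSub s4 rT rT rOne; rewrite (_ : regs s4 _ - _ = k) //=.
  by rewrite T h1; repeat case: eqP => [|_]; lia.
exists (1 + (1 + (1 + (1 + 1))) + t).+1, s'; split.
- apply: ExecWhileT e; first by rewrite T.
  by do 4! [apply: ExecSeq; first by eassumption].
- by lia.
- by rewrite addnS.
- by rewrite Q /=; repeat case: eqP => [|_]; lia.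
Qed.

(** Two nested loops, as the machine cannot multiply to obtain $n^2$. Adding [rP] and subtracting it
    again copies [rN] into [rT]. *)
Definition read_rows : prog :=
  While rQ
    (Seq (Add rT rN rP) (Seq (Defs.Sub rT rT rP)
    (Seq read_row (Defs.Sub rQ rQ rOne)))).

Lemma read_rowsP k j s : reading j s -> regs s rQ = k ->
  exists t s', [/\ exec read_rows s t s', t <= (6 * n + 5) * k + 1 &
    reading (j + k * n) s'].
Proof.
elim: k j s => [|k IHk] j s H Q.
  by exists 1, s; rewrite addn0; split=> //; first exact: ExecWhileF; lia.
have [[hN h1 hNN hP] hM hV hW [hi ho hC]] := H.
pose s2 := set_reg (set_reg s rT (n + regs s rP)) rT n.
have H2 : reading j s2 by apply: reading_scratch H _ _ _ => //; frame.
have [//|t [s3 [e l H3 Q3]]] := @read_rowP n _ _ H2.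
pose s4 := set_reg s3 rQ k.
have H4 : reading (j + n) s4 by apply: reading_scratch H3 _ _ _ => //; frame.
have [//|t' [s' [e' l' H']]] := IHk _ _ H4.
exists (1 + (1 + (t + 1)) + t').+1, s'; split.
- apply: ExecWhileT e'; first by rewrite Q.
  apply: ExecSeq; first exact: ExecAdd.
  apply: (@ExecSeq _ _ _ _ s2).
    have := ExecSub (set_reg s rT (n + regs s rP)) rT rT rP.
    by rewrite /= hN addnK.
  apply: (ExecSeq e).
  have := ExecSub s3 rQ rQ rOne.
  by case: H3 => [[_ -> _ _] _ _ _ _]; rewrite Q3 /= Q subn1.
- by lia.
- by rewrite mulSn addnA.
Qed.

Definition preamble : prog :=
  Seq (Input rN) (Seq (Imm rOne 1) (Seq (Add rNN rN rN) (Seq (Imm rP 1)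
 (Seq (Add rQ rN rP) (Seq (Defs.Sub rQ rQ rOne) read_rows))))).

Lemma preambleP : size m = n * n ->
  exists t s,
    [/\ exec preamble (State (fun=> 0) (n :: m) [::]) t s,
        t <= (6 * n + 5) * n + 7, holds n m [::] s & ghost_of s = ([::], 0)].
Proof.
move=> szm.
pose s0 := set_reg (State (fun=> 0) m [::]) rN n.
pose s1 := set_reg s0 rOne 1.
pose s2 := set_reg s1 rNN (n + n).
pose s3 := set_reg s2 rP 1.
pose s4 := set_reg s3 rQ (n + 1).
pose s5 := set_reg s4 rQ n.
have H : reading 0 s5.
  split=> //=; last by rewrite drop0.
  by move=> k; rewrite take0 nth_nil; repeat case: eqP => [|_] //; lia.
have [t [s [e l [[hN h1 hNN _] hM hV hW [_ ho hC]]]]] :=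
  read_rowsP H (erefl n).
exists (1 + (1 + (1 + (1 + (1 + (1 + t)))))), s; split.
- apply: (@ExecSeq _ _ _ _ s0); first exact: ExecInput.
  apply: (@ExecSeq _ _ _ _ s1); first exact: ExecImm.
  apply: (@ExecSeq _ _ _ _ s2); first exact: ExecAdd.
  apply: (@ExecSeq _ _ _ _ s3); first exact: ExecImm.
  apply: (@ExecSeq _ _ _ _ s4); first exact: ExecAdd.
  apply: (@ExecSeq _ _ _ _ s5) e.
  by have := ExecSub s4 rQ rQ rOne; rewrite /= addn1 subn1.
- by lia.
- split=> // [k|x|x]; rewrite ?hM ?hV ?hW ?nth_nil //.
  by rewrite add0n -szm take_size.
- by rewrite /ghost_of ho hC.
Qed.
End Reading.

(** * Running commands on graphs *)

Lemma nth_allpairs_size (S T : Type) (R : Type) (x0 : R) (f : S -> T -> R)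
    s t a b i j : i < size s -> j < size t ->
  nth x0 [seq f x y | x <- s, y <- t] (i * size t + j) =
  f (nth a s i) (nth b t j).
Proof.
elim: s i => [//|x s IH] [|i] /= si tj; rewrite nth_cat size_map.
  by rewrite tj (nth_map b).
by rewrite mulSn -addnA ltnNge leq_addr /= addKn IH.
Qed.

Section GraphProgram.
Variable G : sgraph.

Definition adjacency : seq nat :=
  [seq nat_of_bool (edge x y) | x <- enum G, y <- enum G].
Definition grun := run #|G| adjacency.

(** Lets a search through the numbers below $n$ be read as a search through the vertices. *)
Lemma map_rk_enum : map rk (enum G) = iota 0 #|G|.
Proof.
apply: (@eq_from_nth _ 0); rewrite size_map -cardE ?size_iota // => i iG.
case/card_gt0P: (leq_ltn_trans (leq0n i) iG) => x0 _.
rewrite (nth_map x0) -?cardE // nth_iota // add0n /rk.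
by rewrite -[i]/(val (Ordinal iG)) -(enum_val_nth x0) enum_valK.
Qed.

Lemma nth_adjacency (x y : G) : nth 0 adjacency (rk x * #|G| + rk y) = edge x y.
Proof.
rewrite {1}cardE (nth_allpairs_size _ _ x x) -?cardE ?ltn_ord //.
by rewrite /rk -!(enum_val_nth x) !enum_rankK.
Qed.

Lemma grun_Adj env g i j (x y : G) : nth 0 env i = rk x -> nth 0 env j = rk y ->
  grun (Adj i j) env g = (edge x y, g).
Proof. by rewrite /grun /= => -> ->; rewrite nth_adjacency lt0b. Qed.

Lemma grun_Ex c env g :
  grun (Ex c) env g = first (fun x : G => grun c (rcons env (rk x))) (enum G) g.
Proof. by rewrite /grun /= -map_rk_enum first_map. Qed.

Lemma grun_Ex_pure c env g (p : pred G) :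
  (forall x g, grun c (rcons env (rk x)) g = (p x, g)) ->
  grun (Ex c) env g = ([exists x, p x], g).
Proof.
move=> cE; rewrite grun_Ex (first_pure cE); congr (_, _).
apply/hasP/existsP => [[x _ px]|[x px]]; exists x => //.
by rewrite mem_enum.
Qed.
End GraphProgram.

(** The time is quadratic for reading the matrix, plus the polynomial [cost c]. *)
Lemma poly_time_cmd (C : sgraph -> Prop)
    (spec : forall G : sgraph, seq nat -> Prop) (c : cmd) :
  (forall G, C G -> spec G (grun G c [::] ([::], 0)).2.1) ->
  poly_time C spec.
Proof.
move=> cP; exists (Seq preamble (compile 0 c)).
exists (((6%:P * 'X + 5%:P) * 'X + 7%:P) + cost c)%R => G CG.
have szm : size (adjacency G) = #|G| * #|G| by rewrite size_allpairs -cardE.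
have [t [s [e l H g]]] := preambleP szm.
have [t' [s' [e' l' H' [_ g']]]] := compileP c H.
exists (t + t'), (output s'); split.
- by exists s' => //; apply: ExecSeq e e'.
- apply: leq_trans (leq_add l l') _.
  by rewrite !(hornerD, hornerM, hornerX, hornerC).
- rewrite g in g'; move: (cP G CG).
  by rewrite -[output s']/((ghost_of s').1) g'.
Qed.

(** * The programs *)

Definition cAnd c c' := Cond c c' (Ret false).
Definition cOr c c' := Cond c (Ret true) c'.
Definition cNot c := Cond c (Ret false) (Ret true).

(* In the following tests, [d] is the length of the environment in which they
   are run, hence the index of the next variable to be bound. *)
Definition cMeets d x y := Ex (cAnd (Adj x d) (Adj y d)).
Definition cNear d x y :=
  cOr (cNot (cOr (Lt x y) (Lt y x))) (cOr (Adj x y) (cMeets d x y)).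
Definition cGood d x y := cAnd (Adj x y) (cNot (cMeets d x y)).
Definition cInGood d x := Ex (cGood d.+1 x d).
Definition cTrue (d x : nat) := Ret true.
Definition cFirst (q : nat -> nat -> cmd) d x :=
  cAnd (q d x)
       (cNot (Ex (cAnd (Lt d x) (cAnd (cNear d.+1 x d) (q d.+1 d))))).
Definition cHasP4 :=
  Ex (Ex (Ex (Ex
    (cAnd (Adj 0 1) (cAnd (Adj 1 2) (cAnd (Adj 2 3)
    (cAnd (cNot (Adj 0 2)) (cAnd (cNot (Adj 1 3)) (cNot (Adj 0 3)))))))))).
(** The final failure keeps the loop going through all vertices. *)
Definition cCount (c : cmd) := Ex (cAnd c (cAnd Inc (Ret false))).
(** The new vertex must exceed all earlier ones, so each set arises from a single tuple. *)
Definition cExtends d :=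
  foldr (fun i => cAnd (cAnd (Lt i d) (cNot (cMeets d.+1 i d))))
        (Ret true) (iota 0 d).
Fixpoint cTuple d k (leaf : cmd) :=
  if k is k'.+1 then Ex (cAnd (cExtends d) (cTuple d.+1 k' leaf)) else leaf.
(** Ends in failure, so that the enclosing search moves on to the next tuple. *)
Definition cEmit k :=
  cAnd (Print k) (foldr (fun i => cAnd (Out i)) (Ret false) (iota 0 k)).
Definition cList K :=
  foldr (fun k => cOr (cTuple 0 k (cEmit k))) (Ret false) (iota 0 K.+1).
(** Sizes are tried downwards, so the first one realised is the maximum if [K] is an upper bound. *)
Fixpoint cMax K :=
  Cond (cTuple 0 K (Ret true)) (Print K)
       (if K is K'.+1 then cMax K' else Ret true).
(** Both counts fail after adding to the same counter, so [cOr] runs them in sequence and then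
    prints the sum. *)
Definition cNumber K :=
  Cond cHasP4 (cMax K)
    (cOr (cOr (cCount (cFirst cTrue 1 0)) (cCount (cFirst cInGood 1 0)))
         PrintCount).

(** * Correctness of the programs *)

Section Decide.
Variable G : sgraph.
Implicit Types (env : seq nat) (x y : G) (t : seq G).

Definition decides env c b := forall g, grun G c env g = (b, g).
Definition binds env i x := i < size env /\ nth 0 env i = rk x.

Lemma binds_rcons env i x v : binds env i x -> binds (rcons env v) i x.
Proof.
by case=> lt_i ix; split; [rewrite size_rcons leqW | rewrite nth_rcons lt_i].
Qed.

Lemma binds_last env x : binds (rcons env (rk x)) (size env) x.
Proof. by split; rewrite ?size_rcons ?nth_rcons ?ltnn ?eqxx. Qed.

Lemma grun_Cond c c1 c2 env g : grun G (Cond c c1 c2) env g =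
  let r := grun G c env g in
  if r.1 then grun G c1 env r.2 else grun G c2 env r.2.
Proof. by []. Qed.

Lemma grun_test c c1 c2 env g b g' : grun G c env g = (b, g') ->
  grun G (Cond c c1 c2) env g =
  if b then grun G c1 env g' else grun G c2 env g'.
Proof. by move=> cE; rewrite grun_Cond cE. Qed.

Lemma decides_And env c c' b b' :
  decides env c b -> decides env c' b' -> decides env (cAnd c c') (b && b').
Proof. by move=> cP c'P g; rewrite grun_Cond cP /=; case: b {cP}. Qed.

Lemma decides_Or env c c' b b' :
  decides env c b -> decides env c' b' -> decides env (cOr c c') (b || b').
Proof. by move=> cP c'P g; rewrite grun_Cond cP /=; case: b {cP}. Qed.

Lemma decides_Not env c b : decides env c b -> decides env (cNot c) (~~ b).
Proof. by move=> cP g; rewrite grun_Cond cP /=; case: b {cP}. Qed.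

Lemma decides_Ex env c (p : pred G) :
  (forall x, decides (rcons env (rk x)) c (p x)) ->
  decides env (Ex c) [exists x, p x].
Proof. by move=> cP g; apply: grun_Ex_pure. Qed.

Lemma decides_Adj env i j x y :
  binds env i x -> binds env j y -> decides env (Adj i j) (edge x y).
Proof. by move=> [_ ix] [_ jy] g; apply: grun_Adj. Qed.

Lemma decides_Lt env i j x y :
  binds env i x -> binds env j y -> decides env (Lt i j) (rk x < rk y).
Proof. by move=> [_ ix] [_ jy] g; rewrite /grun /= ix jy. Qed.

Lemma decides_Meets env i j x y : binds env i x -> binds env j y ->
  decides env (cMeets (size env) i j) (meets x y).
Proof.
move=> ix jy; apply: decides_Ex => z.
by apply: decides_And; apply: decides_Adj (binds_last _ _); apply: binds_rcons.
Qed.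

Lemma decides_Near env i j x y : binds env i x -> binds env j y ->
  decides env (cNear (size env) i j) (near x y).
Proof.
move=> ix jy; apply: decides_Or; last first.
  by apply: decides_Or; [apply: decides_Adj | apply: decides_Meets].
rewrite (_ : (x == y) = ~~ ((rk x < rk y) || (rk y < rk x))).
  by apply/decides_Not/decides_Or; apply: decides_Lt.
by rewrite -neq_ltn negbK (inj_eq (@rk_inj G)).
Qed.

Lemma decides_Good env i j x y : binds env i x -> binds env j y ->
  decides env (cGood (size env) i j) (good_edge x y).
Proof.
move=> ix jy; apply: decides_And; first exact: decides_Adj.
by apply/decides_Not/decides_Meets.
Qed.

Lemma decides_InGood env i x : binds env i x ->
  decides env (cInGood (size env) i) (in_good_edge x).
Proof.
move=> ix; apply: decides_Ex => y; rewrite -(size_rcons env (rk y)).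
by apply: decides_Good (binds_last _ _); apply: binds_rcons.
Qed.

Lemma decides_First q (Q : pred G) env i x :
  (forall env i x, binds env i x -> decides env (q (size env) i) (Q x)) ->
  binds env i x ->
  decides env (cFirst q (size env) i) (x \in firsts Q).
Proof.
move=> qQ ix; rewrite inE; apply: decides_And; first exact: qQ.
apply/decides_Not/decides_Ex => y; rewrite -(size_rcons env (rk y)).
have jy := binds_last env y.
have {}ix := binds_rcons (rk y) ix.
apply: decides_And; first exact: decides_Lt.
by apply: decides_And; [apply: decides_Near | apply: qQ].
Qed.

Lemma decides_HasP4 : decides [::] cHasP4 (has_P4 G).
Proof.
do 4 ![apply: decides_Ex => ?].
by repeat first [apply: decides_And | apply: decides_Not | apply: decides_Adj].
Qed.

Lemma grun_Count env c (A : {set G}) g :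
  (forall x, decides (rcons env (rk x)) c (x \in A)) ->
  grun G (cCount c) env g = (false, (g.1, g.2 + #|A|)).
Proof.
move=> cP; rewrite grun_Ex.
have -> : #|A| = count [in A] (enum G) by rewrite cardE -size_filter enumT.
elim: (enum G) g => [|x s IH] g /=; first by rewrite addn0; case: g.
rewrite -/(grun G c _ g) cP /= IH; case: (x \in A) => //=.
by rewrite addSnnS add1n.
Qed.

Lemma decides_foldr_And (c : nat -> cmd) p s env :
  {in s, forall i, decides env (c i) (p i)} ->
  decides env (foldr (fun i => cAnd (c i)) (Ret true) s) (all p s).
Proof.
elim: s => // i s IH cP; apply: decides_And.
  by apply: cP; apply: mem_head.
by apply: IH => j sj; apply: cP; rewrite inE sj orbT.
Qed.

(** * Increasing tuples and the listing of open packings *)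

Definition sep : rel G := [rel x y | (rk x < rk y) && ~~ meets x y].

Lemma decides_Extends t x :
  decides (rcons (map (@rk G) t) (rk x)) (cExtends (size t)) (all (sep^~ x) t).
Proof.
have -> : all (sep^~ x) t = all (fun i => sep (nth x t i) x) (iota 0 (size t)).
  by rewrite -[in LHS](mkseq_nth x t) all_map.
apply: decides_foldr_And => i.
rewrite mem_iota add0n => /= it.
have ix : binds (rcons (map (@rk G) t) (rk x)) i (nth x t i).
  by apply: binds_rcons; split; rewrite ?size_map // (nth_map x).
have jx := binds_last (map (@rk G) t) x; rewrite size_map in jx.
apply: decides_And; first exact: decides_Lt.
apply: decides_Not.
rewrite -{1}(size_map (@rk G) t) -(size_rcons _ (rk x)).
exact: decides_Meets.
Qed.

Fixpoint extensions k t : seq (seq G) :=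
  if k is k'.+1 then
    flatten [seq extensions k' (rcons t x) | x <- enum G & all (sep^~ x) t]
  else [:: t].

Lemma grun_Tuple leaf k t g :
  grun G (cTuple (size t) k leaf) (map (@rk G) t) g =
  first (fun u => grun G leaf (map (@rk G) u)) (extensions k t) g.
Proof.
elim: k t g => [|k IH] t g.
  rewrite /=; case E: (grun _ _ _ _).1; rewrite //=.
  by case: grun E => ? ? /= ->.
rewrite grun_Ex [extensions _ _]/= first_flatten; apply: eq_in_first => x _ {}g.
rewrite grun_Cond decides_Extends; case: ifP => // _.
by rewrite -IH size_rcons map_rcons.
Qed.

Lemma extensionsP k t u : pairwise sep t ->
  (u \in extensions k t) =
  [&& pairwise sep u, size u == size t + k & take (size t) u == t].
Proof.
elim: k t => [|k IH] t tP /=.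
  rewrite inE addn0; apply/eqP/and3P => [->|[_ /eqP <-]].
    by rewrite tP take_size !eqxx.
  by rewrite take_size => /eqP.
apply/flatten_mapP/and3P => [[x]|[uP szu tu]].
  rewrite mem_filter => /andP[xt _].
  rewrite IH ?pairwise_rcons ?xt // size_rcons addSnnS => /and3P[-> -> tu].
  split=> //; rewrite -[t in _ == t](take_size_cat [:: x] (erefl (size t))).
  by rewrite cats1 -(eqP tu) take_takel.
have tu' : size t < size u by rewrite (eqP szu); lia.
(* Only a default value for [nth]; the next vertex is the entry of [u] at position [size t]. *)
have x0 : G by case: (u) tu' => [|x ?] // _; exact: x.
have e : take (size t).+1 u = rcons t (nth x0 u (size t)).
  by rewrite (take_nth x0) // (eqP tu).
have : pairwise sep (take (size t).+1 u).
  move: uP; rewrite -{1}(cat_take_drop (size t).+1 u) pairwise_cat.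
  by case/and3P.
rewrite e => tP'; exists (nth x0 u (size t)).
  rewrite mem_filter mem_enum andbT.
  by move: tP'; rewrite pairwise_rcons => /andP[].
by rewrite IH // uP size_rcons addSnnS szu e eqxx.
Qed.

(** Different choices of the next vertex give different prefixes, hence disjoint lists. *)
Lemma extensions_uniq k t : pairwise sep t -> uniq (extensions k t).
Proof.
elim: k t => //= k IH t tP.
elim: (enum G) (enum_uniq G) => //= x s IHs /andP[xs /IHs us].
case: ifP => //= xt; rewrite cat_uniq us andbT IH ?pairwise_rcons ?xt //=.
apply/hasPn => u /flatten_mapP[y]; rewrite mem_filter => /andP[yt sy].
have ttP z : all (sep^~ z) t -> pairwise sep (rcons t z).
  by rewrite pairwise_rcons tP => ->.
rewrite !extensionsP ?ttP // !size_rcons => /and3P[_ _ /eqP->].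
apply/negP => /and3P[_ _ /eqP/rcons_inj[yx]].
by rewrite yx (negPf xs) in sy.
Qed.

Lemma mem_extensions0 k u :
  (u \in extensions k [::]) = pairwise sep u && (size u == k).
Proof. by rewrite extensionsP //= take0 eqxx andbT. Qed.

Lemma sorted_enum_set (S : {set G}) : sorted (relpre rk ltn) (enum S).
Proof.
have -> : enum S = [seq x <- enum G | x \in S] by rewrite enumT.
apply: sorted_filter => [y x z|]; first exact: ltn_trans.
by rewrite -sorted_map map_rk_enum iota_ltn_sorted.
Qed.

Lemma pairwise_sep_enum (S : {set G}) :
  open_packing S -> pairwise sep (enum S).
Proof.
move=> /open_packingP SP.
apply: (@sub_in_pairwise _ [in S] (relpre rk ltn)) => [x y Sx Sy /= xy||].
- apply/andP; split=> //; apply: SP => //.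
  by apply: contraTneq xy => ->; rewrite ltnn.
- by apply/allP => x; rewrite mem_enum.
- by rewrite -sorted_pairwise ?sorted_enum_set // => y x z; apply: ltn_trans.
Qed.

(** Both sides are increasing with the same members; thus increasing tuples correspond to sets
    without repetition. *)
Lemma enum_set_sep t : pairwise sep t -> enum [set x in t] = t.
Proof.
rewrite pairwise_relI => /andP[tP _].
apply: (@irr_sorted_eq _ (relpre rk ltn)) => [y x z|x|||x].
- exact: ltn_trans.
- exact: ltnn.
- exact: sorted_enum_set.
- by rewrite sorted_pairwise // => y x z; apply: ltn_trans.
- by rewrite mem_enum inE.
Qed.

Lemma open_packing_sep t : pairwise sep t -> open_packing [set x in t].
Proof.
move=> tP; apply/open_packingP => x y; rewrite !inE => xt yt xy.
have /(pairwiseP x) tN := tP.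
have mt z : z \in t -> index z t \in gtn (size t) by rewrite -index_mem.
case: (ltngtP (index x t) (index y t)) => [lt|lt|eq].
- by have := tN _ _ (mt x xt) (mt y yt) lt; rewrite !nth_index // => /andP[].
- have := tN _ _ (mt y yt) (mt x xt) lt; rewrite !nth_index // => /andP[_].
  by rewrite meets_sym.
- by rewrite -(nth_index x xt) eq nth_index ?eqxx in xy.
Qed.

Lemma encode_set_sep t : pairwise sep t ->
  encode_set [set x in t] = size t :: map (@rk G) t.
Proof. by move=> tP; rewrite /encode_set cardE enum_set_sep. Qed.

Lemma grun_Outs s env g :
  grun G (foldr (fun i => cAnd (Out i)) (Ret false) s) env g =
  (false, (g.1 ++ map (nth 0 env) s, g.2)).
Proof.
elim: s g => [|i s IH] g; first by rewrite cats0; case: g.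
by rewrite grun_Cond /= IH /= cat_rcons.
Qed.

Lemma grun_Emit t g : pairwise sep t ->
  grun G (cEmit (size t)) (map (@rk G) t) g =
  (false, (g.1 ++ encode_set [set x in t], g.2)).
Proof.
move=> tP; rewrite grun_Cond /= grun_Outs encode_set_sep // -cat_rcons.
by rewrite -(size_map (@rk G) t) -/(mkseq _ _) mkseq_nth.
Qed.

Lemma first_Emit k ts g :
  {in ts, forall t, pairwise sep t && (size t == k)} ->
  first (fun t => grun G (cEmit k) (map (@rk G) t)) ts g =
  (false, (g.1 ++ flatten [seq encode_set [set x in t] | t <- ts], g.2)).
Proof.
move=> tsP; rewrite -first_append; apply: eq_in_first => t /tsP.
by case/andP=> tP /eqP <- {}g; apply: grun_Emit.
Qed.

Lemma grun_List K g : grun G (cList K) [::] g =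
  (false, (g.1 ++ flatten
    [seq encode_set [set x in t] |
       t <- flatten [seq extensions k [::] | k <- iota 0 K.+1]], g.2)).
Proof.
rewrite /cList; elim: (iota 0 K.+1) g => [|k s IH] g.
  by rewrite /= cats0; case: g.
rewrite [foldr _ _ _]/= grun_Cond (@grun_Tuple _ _ [::]) first_Emit /=.
  by rewrite IH /= map_cat flatten_cat catA.
by move=> t; rewrite mem_extensions0.
Qed.

Lemma grun_List_spec K :
  (forall S : {set G}, open_packing S -> #|S| <= K) ->
  lists_open_packings G (grun G (cList K) [::] ([::], 0)).2.1.
Proof.
move=> GK; rewrite grun_List.
pose ts := flatten [seq extensions k [::] | k <- iota 0 K.+1].
exists [seq [set x in t] | t <- ts].
have tsP t : t \in ts -> pairwise sep t.
  by case/flatten_mapP => k _; rewrite mem_extensions0 => /andP[].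
split; last by rewrite -map_comp.
- rewrite map_inj_in_uniq => [|t u /tsP tP /tsP uP e]; last first.
    by rewrite -(enum_set_sep tP) e enum_set_sep.
  rewrite /ts.
  elim: (iota 0 K.+1) (iota_uniq 0 K.+1) => //= k s IH /andP[ks us].
  rewrite cat_uniq extensions_uniq // IH // andbT.
  apply/hasPn => t /flatten_mapP[j js]; rewrite !mem_extensions0.
  move=> /andP[-> /eqP ->] /=; apply: contraNneq ks => <-; exact: js.
- move=> S; rewrite [RHS]inE; apply/mapP/idP => [[t /tsP tP ->]|SP].
    exact: open_packing_sep.
  exists (enum S); last by apply/setP => x; rewrite inE mem_enum.
  apply/flatten_mapP; exists #|S|; first by rewrite mem_iota ltnS GK.
  by rewrite mem_extensions0 pairwise_sep_enum // -cardE eqxx.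
Qed.

(** A tuple found at a larger size would be an open packing above the maximum, while a maximum open
    packing, enumerated in order, is found at its own size. *)
Lemma grun_Max K g : open_packing_number G <= K ->
  grun G (cMax K) [::] g = (true, (rcons g.1 (open_packing_number G), g.2)).
Proof.
have test k g' : grun G (cTuple 0 k (Ret true)) [::] g' =
    (has predT (extensions k [::]), g').
  by rewrite (@grun_Tuple _ _ [::]); apply: first_pure.
have attained : has predT (extensions (open_packing_number G) [::]).
  have [S SP <-] := open_packing_number_attained G.
  apply/hasP; exists (enum S) => //.
  by rewrite mem_extensions0 pairwise_sep_enum // -cardE eqxx.
have cMaxE k : cMax k = Cond (cTuple 0 k (Ret true)) (Print k)
    (if k is k'.+1 then cMax k' else Ret true) by case: k.
elim: K g => [|K IH] g; rewrite leq_eqVlt => /orP[/eqP rK|ltK] //;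
    rewrite cMaxE grun_Cond test.
- by rewrite -rK attained.
- by rewrite -rK attained.
- case: hasP => [[t]|_]; last exact: IH.
  rewrite mem_extensions0 => /andP[tP /eqP tK] _.
  have := open_packing_number_ge (open_packing_sep tP).
  by rewrite cardE enum_set_sep // tK leqNgt ltK.
Qed.

Lemma grun_Number_spec K :
  ~~ has_P4 G \/ (forall S : {set G}, open_packing S -> #|S| <= K) ->
  outputs_open_packing_number G (grun G (cNumber K) [::] ([::], 0)).2.1.
Proof.
move=> GK; rewrite /outputs_open_packing_number.
rewrite (grun_test _ _ (decides_HasP4 _)).
case: (boolP (has_P4 G)) GK => [_ [//|GK]|noP4 _].
  rewrite grun_Max //.
  by have [S SP <-] := open_packing_number_attained G; apply: GK.
have all1 g : grun G (cCount (cFirst cTrue 1 0)) [::] g =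
    (false, (g.1, g.2 + #|firsts (@predT G)|)).
  apply: grun_Count => x.
  by apply: (@decides_First _ _ [:: rk x]) => //; apply: (binds_last [::]).
have good1 g : grun G (cCount (cFirst cInGood 1 0)) [::] g =
    (false, (g.1, g.2 + #|firsts (@in_good_edge G)|)).
  apply: grun_Count => x; apply: (@decides_First _ _ [:: rk x]).
    exact: decides_InGood.
  exact: (binds_last [::]).
rewrite P4_free_open_packing_number //.
by rewrite (grun_test _ _ (etrans (grun_test _ _ (all1 _)) (good1 _))).
Qed.
End Decide.

(** * Polynomial time for the four classes *)

Lemma poly_time_lists (C : sgraph -> Prop) K :
  (forall G, C G -> forall S : {set G}, open_packing S -> #|S| <= K) ->
  poly_time C lists_open_packings.
Proof.
move=> CK; apply: (poly_time_cmd (c := cList K)) => G /CK.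
exact: grun_List_spec.
Qed.

Lemma poly_time_number (C : sgraph -> Prop) K :
  (forall G, C G ->
     ~~ has_P4 G \/ forall S : {set G}, open_packing S -> #|S| <= K) ->
  poly_time C outputs_open_packing_number.
Proof.
move=> CK; apply: (poly_time_cmd (c := cNumber K)) => G /CK.
exact: grun_Number_spec.
Qed.

(** Treats $P_4$, $P_3$ and $K_2$ alike. For the number, a graph with an induced $P_4$ contains [F],
    so its open packings are bounded; the other graphs fall under the component formula. *)
Lemma union_edgeless_free (F : sgraph) r : #|F| <= 4 ->
  (forall G, has_P4 G -> contains_induced F G) ->
  let H := disjoint_union F (edgeless_graph r) in
  [/\ few_open_packings (enumerable_class F H),
      poly_time (enumerable_class F H) lists_open_packings
    & poly_time (induced_free H) outputs_open_packing_number].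
Proof.
move=> F4 P4F H.
have bound G : enumerable_class F H G ->
    forall S : {set G}, open_packing S -> #|S| <= 2 * r + 8.
  by move=> CG S; apply: card_open_packing_enumerable CG; [|apply: P4F].
split; [exact: few_open_packings_bounded bound|exact: poly_time_lists bound|].
apply: (poly_time_number (K := 2 * r + 8)) => G free.
case: (boolP (has_P4 G)) => [P4|]; last by left.
by right; apply: bound; split; [|right; apply: P4F].
Qed.

Theorem theorem8 (r : nat) :
  [/\ let H := disjoint_union (path_graph 4) (edgeless_graph r) in
      [/\ few_open_packings (enumerable_class (path_graph 4) H),
          poly_time (enumerable_class (path_graph 4) H) lists_open_packings
        & poly_time (induced_free H) outputs_open_packing_number],
      let H := disjoint_union (path_graph 3) (edgeless_graph r) in
      [/\ few_open_packings (enumerable_class (path_graph 3) H),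
          poly_time (enumerable_class (path_graph 3) H) lists_open_packings
        & poly_time (induced_free H) outputs_open_packing_number],
      1 <= r ->
      let H := disjoint_union (complete_graph 2) (edgeless_graph r) in
      [/\ few_open_packings (enumerable_class (complete_graph 2) H),
          poly_time (enumerable_class (complete_graph 2) H) lists_open_packings
        & poly_time (induced_free H) outputs_open_packing_number]
    & 3 <= r ->
      let H := edgeless_graph r in
      [/\ few_open_packings (induced_free H),
          poly_time (induced_free H) lists_open_packings
        & poly_time (induced_free H) outputs_open_packing_number]].
Proof.
split=> [||_|_].
- by apply: union_edgeless_free => [|G /has_P4_contains[]]; rewrite ?card_ord.
- by apply: union_edgeless_free => [|G /has_P4_contains[]]; rewrite ?card_ord.
- by apply: union_edgeless_free => [|G /has_P4_contains[]]; rewrite ?card_ord.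
(* Half of an open packing is independent, so its size is bounded whether or not the graph is
   connected. *)
have bound G : induced_free (edgeless_graph r) G ->
    forall S : {set G}, open_packing S -> #|S| <= 2 * r.
  by move=> free S; apply: card_open_packing_edgeless_free.
split; [exact: few_open_packings_bounded bound|exact: poly_time_lists bound|].
by apply: (poly_time_number (K := 2 * r)) => G /bound bG; right.
Qed.
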